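(* Let $\mathrm{FIM}_X$ be the monogenic free inverse monoid generated by $X=\{a\}$. Then the languages $\mathcal{R}\text{-}\mathrm{Geo}(\mathrm{FIM}_X)$, $\mathcal{L}\text{-}\mathrm{Geo}(\mathrm{FIM}_X)$ and $\mathcal{H}\text{-}\mathrm{Geo}(\mathrm{FIM}_X)$ are not regular.
   Context: $\tilde X=\{a,a^{-1}\}$; $\pi:\tilde X^*\to \mathrm{FIM}_X$ is the canonical surjective homomorphism; $\ell(w)$ is the length of the word $w$. For $\mathcal{K}\in\{\mathcal{R},\mathcal{L},\mathcal{H}\}$ the corresponding Green's relation on $\mathrm{FIM}_X$, $$\mathcal{K}\text{-}\mathrm{Geo}(\mathrm{FIM}_X)=\bigl\{w\in\tilde X^*: \ell(w)=\min\{\ell(u): u\in\tilde X^*,\ (u\pi)\,\mathcal{K}\,(w\pi)\}\bigr\}.$$ *)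

(* Defs.v *)
From HB Require Import structures.
From mathcomp Require Import all_boot.
From mathcomp Require Import boolp classical_sets.

Set Implicit Arguments.
Unset Strict Implicit.
Unset Printing Implicit Defensive.

Local Open Scope classical_set_scope.
Local Open Scope quotient_scope.

(* Words over the doubled alphabet X u X^-1: the letter (x, true) stands for x
   and the letter (x, false) for x^-1. *)
Definition word (X : Type) := seq (X * bool).

Definition winv (X : Type) (w : word X) : word X :=
  rev [seq (p.1, ~~ p.2) | p <- w].

(* The congruence on words generated by the pairs (w w^-1 w, w) and
   (w w^-1 z z^-1, z z^-1 w w^-1). *)
Inductive vagner (X : Type) : word X -> word X -> Prop :=
| vagner_inv w : vagner (w ++ winv w ++ w) w
| vagner_comm w z :
    vagner (w ++ winv w ++ z ++ winv z) (z ++ winv z ++ w ++ winv w)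
| vagner_refl w : vagner w w
| vagner_sym u v : vagner u v -> vagner v u
| vagner_trans u v w : vagner u v -> vagner v w -> vagner u w
| vagner_cat u1 v1 u2 v2 :
    vagner u1 v1 -> vagner u2 v2 -> vagner (u1 ++ u2) (v1 ++ v2).

Section FreeInverseMonoid.
Variable X : choiceType.

Definition vagnerb (u v : word X) : bool := `[< vagner u v >].

Lemma vagnerb_refl : reflexive vagnerb.
Proof. by move=> u; apply/asboolP; apply: vagner_refl. Qed.

Lemma vagnerb_sym : symmetric vagnerb.
Proof. by move=> u v; apply/asboolP/asboolP; apply: vagner_sym. Qed.

Lemma vagnerb_trans : transitive vagnerb.
Proof.
by move=> v u w /asboolP uv /asboolP vw; apply/asboolP; apply: vagner_trans vw.
Qed.

Canonical vagner_equiv :=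
  EquivRel vagnerb vagnerb_refl vagnerb_sym vagnerb_trans.

Definition FIM := {eq_quot vagner_equiv}.
HB.instance Definition _ := Choice.on FIM.
HB.instance Definition _ := EqQuotient.on FIM.

Definition fim_pi (w : word X) : FIM := \pi_FIM w.

Lemma fim_piP u v : fim_pi u = fim_pi v <-> vagner u v.
Proof.
split=> [/eqP|uv]; first by rewrite eqmodE => /asboolP.
by apply/eqP; rewrite eqmodE; apply/asboolP.
Qed.

Definition fim_one : FIM := fim_pi [::].
Definition fim_mul (s t : FIM) : FIM := fim_pi (repr s ++ repr t).

Lemma fim_reprK (s : FIM) : fim_pi (repr s) = s.
Proof. exact: reprK. Qed.

Lemma fim_mul_pi u v : fim_mul (fim_pi u) (fim_pi v) = fim_pi (u ++ v).
Proof. by apply/fim_piP/vagner_cat; apply/fim_piP; apply: fim_reprK. Qed.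

Lemma fim_mulA : associative fim_mul.
Proof.
move=> r s t; rewrite -[r]fim_reprK -[s]fim_reprK -[t]fim_reprK.
by rewrite !fim_mul_pi catA.
Qed.

Lemma fim_mul1 : left_id fim_one fim_mul.
Proof. by move=> s; rewrite -[s]fim_reprK fim_mul_pi. Qed.

Lemma fim_mulr1 : right_id fim_one fim_mul.
Proof. by move=> s; rewrite -[s]fim_reprK fim_mul_pi cats0. Qed.

HB.instance Definition _ := isMonoid.Build FIM fim_mulA fim_mul1 fim_mulr1.

Lemma fim_piM u v : fim_pi (u ++ v) = (fim_pi u * fim_pi v)%g.
Proof. by rewrite -fim_mul_pi. Qed.

Lemma fim_pi_surj (s : FIM) : exists w, fim_pi w = s.
Proof. by exists (repr s); apply: fim_reprK. Qed.

End FreeInverseMonoid.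

Definition green_R (M : monoidType) (s t : M) : Prop :=
  [set (s * m)%g | m in [set: M]] = [set (t * m)%g | m in [set: M]].

Definition green_L (M : monoidType) (s t : M) : Prop :=
  [set (m * s)%g | m in [set: M]] = [set (m * t)%g | m in [set: M]].

Definition green_H (M : monoidType) (s t : M) : Prop :=
  green_R s t /\ green_L s t.

Definition is_min (S : set nat) (n : nat) : Prop :=
  S n /\ forall m, S m -> n <= m.

Definition Geo (X : choiceType) (K : FIM X -> FIM X -> Prop) : set (word X) :=
  [set w | is_min [set size u | u in [set u | K (fim_pi u) (fim_pi w)]]
                  (size w)].

Definition regular (A : finType) (L : set (seq A)) : Prop :=
  exists (Q : finType) (q0 : Q) (F : {set Q}) (delta : Q -> A -> Q),
    forall w : seq A, L w <-> foldl delta q0 w \in F.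

(* Main.v *)
Require Import Defs.
From mathcomp Require Import all_boot.
From mathcomp Require Import boolp classical_sets.
From mathcomp Require Import zify.

(** A word over the doubled alphabet is read as a walk on the integer line that
    starts at 0, goes up along a letter of sign [true] and down along a letter of
    sign [false]; [reach true w] and [reach false w] are the distances from 0 to
    the highest and to the lowest point visited.  Since [act_vagner] makes these
    extreme points functions of the element represented, an R-class determines
    both of them, and an H-class determines in addition the distances from the
    end point to the extremes, which are the extremes of the inverse word.

    The length estimates come from [span]: a walk that visits both ends of an
    interval makes at least as many up-steps, or at least as many down-steps, as
    the width of that interval.  Visiting the nearer end first is therefore
    optimal, and a walk that visits the farther end first is too long.  Writing
    b for the inverse of a, this yields the following thresholds:
    - b^i a^(2k+1) is R-geodesic for i <= k, but not for i = k+1, when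
      a^k b^(2k+1) is a shorter word in the same R-class;
    - b^(2k+1) a^i is L-geodesic for i <= k, but not for i = k+1, by inversion;
    - b a^(n+1) b^s is H-geodesic for s <= n, but not for s = n+1, when
      a^n b^(n+1) is a shorter word for the same element.

    The shorter words all come from the commutation of idempotents, in the form
    w w^-1 z z^-1 w = z z^-1 w ([vagner_absorb]).  In each of the three languages
    the thresholds give infinitely many prefixes with pairwise different sets of
    continuations, whereas a finite automaton has only finitely many states to
    tell prefixes apart ([not_regular]). *)

Set Implicit Arguments.
Unset Strict Implicit.
Unset Printing Implicit Defensive.

Local Open Scope classical_set_scope.

(** * Separation of prefixes by regular languages *)

(** One half of the Myhill-Nerode theorem: two of more prefixes than states lead
    to the same state, hence have the same continuations. *)
Lemma not_regular (A : finType) (L : set (seq A)) (u : nat -> seq A) :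
    (forall i j, i < j -> exists v, ~ (L (u i ++ v) <-> L (u j ++ v))) ->
  ~ regular L.
Proof.
move=> sep [Q [q0 [F [delta LF]]]].
pose f (i : 'I_#|Q|.+1) := foldl delta q0 (u i).
have /injectivePn[x [y neq_xy fxy]] : ~~ injectiveb f.
  by apply/injectiveP => /leq_card; rewrite card_ord ltnn.
have same v : L (u x ++ v) <-> L (u y ++ v).
  by rewrite !LF !foldl_cat -/(f x) -/(f y) fxy.
have [lt_xy|lt_yx|/val_inj eq_xy] := ltngtP (x : nat) y.
- by have [v] := sep _ _ lt_xy; case.
- by have [v] := sep _ _ lt_yx; case; split=> /same.
- by rewrite eq_xy eqxx in neq_xy.
Qed.

(** * Walks on the integer line *)

Section Walk.
Variable X : Type.
Implicit Types (u v w z : word X) (s : bool).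

Lemma winv_cat u v : winv (u ++ v) = winv v ++ winv u.
Proof. by rewrite /winv map_cat rev_cat. Qed.

Lemma winvK : involutive (@winv X).
Proof.
move=> w; rewrite /winv map_rev revK -map_comp -[RHS]map_id.
by apply: eq_map => -[x b] /=; rewrite negbK.
Qed.

Lemma size_winv w : size (winv w) = size w.
Proof. by rewrite size_rev size_map. Qed.

Lemma vagner_winv u v : vagner u v -> vagner (winv u) (winv v).
Proof.
elim=> {u v} [w|w z|w|u v _ IH|u v w _ uv _ vw|u1 v1 u2 v2 _ IH1 _ IH2].
- by rewrite !winv_cat -catA; apply: vagner_inv.
- by rewrite !winv_cat !winvK -!catA; apply: vagner_comm.
- exact: vagner_refl.
- exact: vagner_sym.
- exact: vagner_trans uv vw.
- by rewrite !winv_cat; apply: vagner_cat.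
Qed.

(** [act s w k] is the distance from 0 to the farthest point visited in direction
    [s] when the walk [w] is followed, from its end point, by an excursion to
    distance [k] in that direction; the truncation
    of the predecessor at 0 accounts for the starting point, which is always
    visited.  The letters thus act through the generators of the bicyclic
    monoid, which is an inverse monoid. *)
Definition act s w k := foldr (fun p n => if p.2 == s then n.+1 else n.-1) k w.

Definition reach s w := act s w 0.

Definition steps s w := count (fun p => p.2 == s) w.

Lemma act_cat s u v k : act s (u ++ v) k = act s u (act s v k).
Proof. by rewrite /act foldr_cat. Qed.

Lemma act_mono s w : {homo act s w : m n / m <= n}.
Proof. by move=> m n le_mn; elim: w => //= -[x b] w IH /=; case: ifP => _; lia. Qed.

Lemma winv_cons p w : winv (p :: w) = rcons (winv w) (p.1, ~~ p.2).
Proof. by rewrite /winv map_cons rev_cons. Qed.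

(** The closed walk [w ++ winv w] returns to 0 after visiting what [w] visits. *)
Lemma act_idem s w k : act s w (act s (winv w) k) = maxn k (reach s w).
Proof.
elim: w k => [|[x b] w IH] k; first by rewrite maxn0.
rewrite winv_cons -cats1 act_cat [act s (_ :: _) _]/= IH /reach /=.
by case: s {IH}; case: b => /=; lia.
Qed.

Lemma act_vagner u v s k : vagner u v -> act s u k = act s v k.
Proof.
move=> uv; elim: uv k => {u v} [w|w z|//|u v _ IH|u v w _ uv _ vw|? ? ? ? _ IH1 _ IH2] k.
- by rewrite !act_cat act_idem; apply/maxn_idPl/act_mono.
- by rewrite !(act_cat, act_idem) maxnAC.
- by rewrite IH.
- by rewrite uv vw.
- by rewrite !act_cat IH2 IH1.
Qed.

Lemma size_steps w : size w = steps true w + steps false w.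
Proof. by elim: w => //= -[x [] w ->] /=; rewrite ?add1n ?add0n ?addSn ?addnS. Qed.

Lemma reach_steps s w : reach s w <= steps s w.
Proof. by elim: w => //= -[x b] w; rewrite /reach /=; case: eqP => _ /=; lia. Qed.

(** Between its visits to the two extremes the walk crosses the whole interval,
    upwards or downwards according to which of them it visits first. *)
Lemma span w :
  let width := reach true w + reach false w in
  width <= steps true w \/ width <= steps false w.
Proof.
elim: w => [|[x b] w] /=; first by left.
have := reach_steps true w; have := reach_steps false w.
by rewrite /reach /=; case: b => /=; lia.
Qed.

(** The distance from the end point to the highest point, computed once as an
    extreme of the reversed walk and once from the net number of steps. *)
Lemma reach_winv w :
  reach true (winv w) + steps true w = reach true w + steps false w.
Proof.
(* Induction needs an arbitrary excursion [k] in place of 0. *)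
suff balance k :
    act true w (act true (winv w) k) + steps false w
      = act true (winv w) k + steps true w.
  by rewrite -[LHS](balance 0) act_idem max0n.
elim: w k => [|[x b] w IH] k; first by [].
rewrite winv_cons -cats1 act_cat [act _ (_ :: _) _]/= /=.
case: b => /=; first by have := IH k.-1; lia.
(* The excursion has become [k.+1], so that the predecessor is not truncated. *)
by have := IH k.+1; rewrite act_idem; lia.
Qed.

Lemma vagner_absorb w z :
  vagner (w ++ winv w ++ z ++ winv z ++ w) (z ++ winv z ++ w).
Proof.
apply: (@vagner_trans _ _ (z ++ winv z ++ w ++ winv w ++ w)).
  have := vagner_cat (vagner_comm w z) (vagner_refl w).
  by rewrite -!catA.
have := vagner_cat (vagner_refl (z ++ winv z)) (vagner_inv w).
by rewrite -!catA.
Qed.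

End Walk.

(** * Green's relations and geodesics in terms of words *)

Section Green.
Variable X : choiceType.
Implicit Types (u v w z : word X).

Lemma green_R_words u v : green_R (fim_pi u) (fim_pi v) <->
  (exists x, vagner (u ++ x) v) /\ (exists y, vagner (v ++ y) u).
Proof.
have half w z : (exists x, vagner (w ++ x) z) <->
    [set (fim_pi z * m)%g | m in [set: FIM X]]
      `<=` [set (fim_pi w * m)%g | m in [set: FIM X]].
  split=> [[x /fim_piP wxz] _ [m _ <-]|sub].
    by exists (fim_pi x * m)%g; rewrite // monoid.mulgA -fim_piM wxz.
  have [|m _] := sub (fim_pi z); first by exists 1%g; rewrite ?monoid.mulg1.
  by have [x <-] := fim_pi_surj m; rewrite -fim_piM => /fim_piP; exists x.
rewrite !half; split=> [->|[vu uv]]; first by split.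
by apply/seteqP; split.
Qed.

Lemma green_L_words u v : green_L (fim_pi u) (fim_pi v) <->
  (exists x, vagner (x ++ u) v) /\ (exists y, vagner (y ++ v) u).
Proof.
have half w z : (exists x, vagner (x ++ w) z) <->
    [set (m * fim_pi z)%g | m in [set: FIM X]]
      `<=` [set (m * fim_pi w)%g | m in [set: FIM X]].
  split=> [[x /fim_piP xwz] _ [m _ <-]|sub].
    by exists (m * fim_pi x)%g; rewrite // -monoid.mulgA -fim_piM xwz.
  have [|m _] := sub (fim_pi z); first by exists 1%g; rewrite ?monoid.mul1g.
  by have [x <-] := fim_pi_surj m; rewrite -fim_piM => /fim_piP; exists x.
rewrite !half; split=> [->|[vu uv]]; first by split.
by apply/seteqP; split.
Qed.

Lemma green_L_winv u v : green_L (fim_pi u) (fim_pi v) <->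
  green_R (fim_pi (winv u)) (fim_pi (winv v)).
Proof.
have half w z :
    (exists x, vagner (x ++ w) z) <-> (exists x, vagner (winv w ++ x) (winv z)).
  split=> -[x /vagner_winv]; rewrite winv_cat ?winvK => xwz; last by exists (winv x).
  by exists (winv x).
by rewrite green_L_words green_R_words !half.
Qed.

Lemma green_R_reach s u v :
  green_R (fim_pi u) (fim_pi v) -> reach s u = reach s v.
Proof.
have half w z : (exists x, vagner (w ++ x) z) -> reach s w <= reach s z.
  by case=> x /(act_vagner s 0); rewrite /reach => <-; rewrite act_cat act_mono.
by case/green_R_words=> /half uv /half vu; apply/eqP; rewrite eqn_leq uv.
Qed.

(** Both words visit the union of the ranges of [w] and [z], in opposite orders. *)
Lemma green_R_swap w z :
  green_R (fim_pi (z ++ winv z ++ w)) (fim_pi (w ++ winv w ++ z)).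
Proof.
apply/green_R_words; split.
  by exists (winv w ++ z); rewrite -!catA; apply: vagner_absorb.
by exists (winv z ++ w); rewrite -!catA; apply: vagner_absorb.
Qed.

Lemma GeoP (K : FIM X -> FIM X -> Prop) w : (forall s, K s s) ->
  Geo K w <-> forall u, K (fim_pi u) (fim_pi w) -> size w <= size u.
Proof.
move=> Krefl; split=> [[_ min_w] u Kuw|min_w].
  by apply: min_w; exists u.
by split=> [|_ [u Kuw <-]]; [exists w; first exact: Krefl | apply: min_w].
Qed.

Lemma Geo_L_winv w : Geo (@green_L (FIM X)) w <-> Geo (@green_R (FIM X)) (winv w).
Proof.
rewrite !GeoP //; split=> min_w u Kuw.
  by rewrite size_winv -(size_winv u); apply: min_w; apply/green_L_winv; rewrite winvK.
by rewrite -(size_winv w) -(size_winv u); apply/min_w/green_L_winv.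
Qed.

(** * The threshold words *)

Variable a : X.

Definition pow (b : bool) n : word X := nseq n (a, b).

Lemma powD b m n : pow b (m + n) = pow b m ++ pow b n.
Proof. by rewrite /pow nseqD. Qed.

Lemma winv_pow b n : winv (pow b n) = pow (~~ b) n.
Proof. by rewrite /winv /pow map_nseq rev_nseq. Qed.

Lemma act_pow s b n k :
  act s (pow b n) k = if b == s then n + k else k - n.
Proof.
elim: n => [|n /= ->]; first by rewrite subn0; case: ifP.
by case: (b == s); lia.
Qed.

Definition actE := (act_cat, act_pow).

Lemma Geo_R_pow i k :
  i <= k -> Geo (@green_R (FIM X)) (pow false i ++ pow true k.*2.+1).
Proof.
move=> le_ik; apply/GeoP => // u Ruw.
have := green_R_reach true Ruw; have := green_R_reach false Ruw.
have := reach_steps true u; have := reach_steps false u; have := span u.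
by rewrite (size_steps u) size_cat !size_nseq /reach !actE /=; lia.
Qed.

Lemma not_Geo_R_pow k :
  ~ Geo (@green_R (FIM X)) (pow false k.+1 ++ pow true k.*2.+1).
Proof.
have -> : k.*2.+1 = k.+1 + k by lia.
move/GeoP=> /(_ (fun=> erefl) (pow true k ++ pow false k ++ pow false k.+1)).
(* The given word is w w^-1 z and the shorter one is z z^-1 w, for w = b^(k+1)
   and z = a^k. *)
have := green_R_swap (pow false k.+1) (pow true k).
rewrite !winv_pow powD => /[swap]/[apply].
by rewrite !size_cat !size_nseq; lia.
Qed.

Lemma Geo_H_pow n s : s <= n ->
  Geo (@green_H (FIM X)) ((pow false 1 ++ pow true n.+1) ++ pow false s).
Proof.
move=> le_sn; apply/GeoP => // u [Ruw /green_L_winv Luw].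
have := green_R_reach true Ruw; have := green_R_reach false Ruw.
have := green_R_reach true Luw; have := reach_winv u; have := span u.
rewrite (size_steps u) !size_cat !size_nseq !winv_cat !winv_pow.
by rewrite /reach !actE /=; lia.
Qed.

Lemma not_Geo_H_pow n :
  ~ Geo (@green_H (FIM X)) ((pow false 1 ++ pow true n.+1) ++ pow false n.+1).
Proof.
move/GeoP=> /(_ (fun=> conj erefl erefl) (pow true n ++ pow false n.+1)).
have -> : fim_pi (pow true n ++ pow false n.+1) =
          fim_pi ((pow false 1 ++ pow true n.+1) ++ pow false n.+1).
  apply/fim_piP/vagner_sym.
  (* The longer word is w w^-1 z z^-1 w, for w = b and z = a^n. *)
  rewrite {1}[n.+1]/(1 + n) -[n.+1]addn1 !powD -!catA.
  by have := vagner_absorb (pow false 1) (pow true n); rewrite !winv_pow.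
by move=> /(_ (conj erefl erefl)); rewrite !size_cat !size_nseq; lia.
Qed.

End Green.

Theorem mainTheorem13 (X : finType) (a : X) (hX : [set: X] = [set a]) :
  [/\ ~ regular (Geo (@green_R (FIM X))),
      ~ regular (Geo (@green_L (FIM X)))
    & ~ regular (Geo (@green_H (FIM X)))].
Proof.
split.
- apply: (@not_regular _ _ (pow a false)) => i [//|j] lt_ij.
  exists (pow a true j.*2.+1) => -[/(_ (Geo_R_pow a (i := i) lt_ij))].
  by move=> /not_Geo_R_pow.
- apply: (@not_regular _ _ (fun k => pow a false k.*2.+1)) => i j lt_ij.
  exists (pow a true i.+1) => -[_].
  rewrite !Geo_L_winv !winv_cat !winv_pow /= => /(_ (Geo_R_pow a lt_ij)).
  exact: not_Geo_R_pow.
- apply: (@not_regular _ _ (fun n => pow a false 1 ++ pow a true n.+1)) => i j lt_ij.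
  exists (pow a false i.+1) => -[_ /(_ (Geo_H_pow a lt_ij))].
  exact: not_Geo_H_pow.
Qed.
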